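(* Let $(G,S)$ and $(H,S')$ be two co-recursively presented marked groups, and suppose that $(H,S')$ is a strict marked quotient of $(G,S)$. Then no algorithm that takes as input co-recursive presentations of either $(G,S)$ or $(H,S')$ can stop exactly on the presentations that define $(H,S')$. That is, there is no partial computable function $F:\subseteq\mathbb{N}\to\mathbb{N}$ such that for every $p\in\mathrm{dom}(\nu_{co-RP})$ with $\nu_{co-RP}(p)\in\{(G,S),(H,S')\}$, $F(p)$ is defined if and only if $\nu_{co-RP}(p)=(H,S')$.
   Context: A $k$-marked group is a pair $(G,S)$ with $G$ a group and $S=(s_1,\dots,s_k)\in G^k$ a tuple generating $G$. A morphism $(G,S)\to(H,S')$ of $k$-marked groups is a group homomorphism sending $s_i$ to $s_i'$ for each $i$; marked groups are considered up to isomorphism of marked groups. $(H,S')$ is a marked quotient of $(G,S)$ if there is a morphism $(G,S)\to(H,S')$; strict if moreover they are not isomorphic as marked groups. Let $\langle n,m\rangle$ be a computable bijection $\mathbb{N}^2\to\mathbb{N}$ with computable inverse, $\mathcal{A}_n=\{x_1,\dots,x_n\}$, $\theta_n:\mathbb{N}\to(\mathcal{A}_n\cup\mathcal{A}_n^{-1})^*$ a natural computable bijection uniformly in $n\ge1$, $\varphi_0,\varphi_1,\dots$ a standard enumeration of the partial computable functions, $W_i=\mathrm{dom}(\varphi_i)$. The co-word problem of an $n$-marked group is the set of all words in $(\mathcal{A}_n\cup\mathcal{A}_n^{-1})^*$ defining non-identity elements. The numbering of co-recursive presentations is $\nu_{co-RP}(\langle n,i\rangle)=\langle\mathcal{A}_n\mid(\theta_n(W_i))^c\rangle$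 (marked by $(x_1,\dots,x_n)$, complement in $(\mathcal{A}_n\cup\mathcal{A}_n^{-1})^*$), with domain the set of $\langle n,i\rangle$ such that $\theta_n(W_i)$ is the co-word problem of some $n$-marked group. A marked group is co-recursively presented if it is in the image of $\nu_{co-RP}$. *)

(* Defs.v *)
From HB Require Import structures.
From mathcomp Require Import all_boot generic_quotient.
From mathcomp Require Import boolp classical_sets.

Set Implicit Arguments.
Unset Strict Implicit.
Unset Printing Implicit Defensive.

Local Open Scope group_scope.
Local Open Scope classical_set_scope.

(** Partial functions are represented by their graphs.  [code] is the usual
    class of programs for unary mu-recursive functions, several arguments
    being packed with the Cantor pairing function. *)

Definition cantor (a b : nat) : nat := 'C((a + b).+1, 2) + b.

Inductive code : Type :=
| Zero
| Succ
| Left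
| Right
| Pair of code & code
| Comp of code & code
| Prec of code & code
| Mu of code.

Inductive eval : code -> nat -> nat -> Prop :=
| eval_zero x : eval Zero x 0
| eval_succ x : eval Succ x x.+1
| eval_left a b : eval Left (cantor a b) a
| eval_right a b : eval Right (cantor a b) b
| eval_pair f g x y z :
    eval f x y -> eval g x z -> eval (Pair f g) x (cantor y z)
| eval_comp f g x y z :
    eval g x y -> eval f y z -> eval (Comp f g) x z
| eval_prec0 f g a y :
    eval f a y -> eval (Prec f g) (cantor a 0) y
| eval_precS f g a n y z :
    eval (Prec f g) (cantor a n) y ->
    eval g (cantor a (cantor n y)) z ->
    eval (Prec f g) (cantor a n.+1) z
| eval_mu f a n :
    eval f (cantor a n) 0 ->
    (forall m, m < n -> exists y, eval f (cantor a m) y.+1) ->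
    eval (Mu f) a n.

Definition pfun : Type := nat -> nat -> Prop.

Definition defined (F : pfun) (x : nat) : Prop := exists y, F x y.

Definition partial_computable (F : pfun) : Prop :=
  exists c, forall x y, F x y <-> eval c x y.

Definition computable (f : nat -> nat) : Prop :=
  exists c, forall x, eval c x (f x).

Definition computable2 (f : nat -> nat -> nat) : Prop :=
  exists c, forall x y, eval c (cantor x y) (f x y).

Fixpoint goedel (c : code) : nat :=
  match c with
  | Zero => cantor 0 0
  | Succ => cantor 1 0
  | Left => cantor 2 0
  | Right => cantor 3 0
  | Pair f g => cantor 4 (cantor (goedel f) (goedel g))
  | Comp f g => cantor 5 (cantor (goedel f) (goedel g))
  | Prec f g => cantor 6 (cantor (goedel f) (goedel g))
  | Mu f => cantor 7 (goedel f)
  end.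

(** Numbers which are not the Goedel number of a program denote the nowhere
    defined function. *)
Definition goedel_fun (i : nat) : pfun :=
  fun x y => exists c, goedel c = i /\ eval c x y.

(** Acceptable numberings in the sense of Rogers: those which are
    intertranslatable with the Goedel numbering. *)
Definition standard_enumeration (phi : nat -> pfun) : Prop :=
  (exists f, computable f /\
     forall i x y, phi i x y <-> goedel_fun (f i) x y) /\
  (exists g, computable g /\
     forall i x y, goedel_fun i x y <-> phi (g i) x y).

Definition W (phi : nat -> pfun) (i : nat) : set nat := [set x | defined (phi i) x].

Definition computable_pairing (pr : nat -> nat -> nat) : Prop :=
  computable2 pr /\
  exists u v : nat -> nat,
    [/\ computable u, computable v,
        forall n m, u (pr n m) = n /\ v (pr n m) = m
      & forall p, pr (u p) (v p) = p].

(** [(i, false)] is the letter x_i and [(i, true)] its formal inverse. *)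
Definition word (n : nat) : Type := seq ('I_n * bool).

Definition letter_code n (l : 'I_n * bool) : nat := (l.1).*2 + l.2.

Fixpoint word_code n (w : word n) : nat :=
  if w is l :: w' then (cantor (letter_code l) (word_code w')).+1 else 0.

(** The inverse bijections are then also computable, uniformly in n, by
    exhaustive search. *)
Definition computable_word_numbering (theta : forall n, nat -> word n) : Prop :=
  (forall n, 0 < n -> bijective (theta n)) /\
  (exists c, forall n m, 0 < n -> eval c (cantor n m) (word_code (theta n m))).

Definition word_val (G : groupType) n (S : n.-tuple G) (w : word n) : G :=
  \prod_(l <- w) (if l.2 then (tnth S l.1)^-1 else tnth S l.1).

(** The [choiceType] structure contained in [groupType] is no restriction on
    the group, since every type has one classically. *)
Record marked_group (k : nat) := MarkedGroup {
  carrier :> groupType;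
  marking : k.-tuple carrier;
  marking_generates : forall g : carrier, exists w, word_val marking w = g }.

Definition marked_morphism k (G H : marked_group k) (f : G -> H) : Prop :=
  (forall x y, f (x * y) = f x * f y) /\
  (forall i, f (tnth (marking G) i) = tnth (marking H) i).

Definition marked_iso k (G H : marked_group k) : Prop :=
  exists f : G -> H, marked_morphism f /\ bijective f.

Definition marked_quotient k (G H : marked_group k) : Prop :=
  exists f : G -> H, marked_morphism f.

Definition strict_marked_quotient k (G H : marked_group k) : Prop :=
  marked_quotient G H /\ ~ marked_iso G H.

Definition coword_problem k (G : marked_group k) : set (word k) :=
  [set w | word_val (marking G) w <> 1].

(** The group presented by R is the quotient of the monoid of words by the
    congruence generated by R and the cancellation of inverse letters. *)

Inductive pres_eq n (R : set (word n)) : word n -> word n -> Prop :=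
| pres_refl u : pres_eq R u u
| pres_sym u v : pres_eq R u v -> pres_eq R v u
| pres_trans u v w : pres_eq R u v -> pres_eq R v w -> pres_eq R u w
| pres_cat u u' v v' :
    pres_eq R u u' -> pres_eq R v v' -> pres_eq R (u ++ v) (u' ++ v')
| pres_cancel i b : pres_eq R [:: (i, b); (i, ~~ b)] [::]
| pres_rel r : R r -> pres_eq R r [::].

Section Presentation.
Variables (n : nat) (R : set (word n)).

Definition pres_rel_bool : rel (word n) := fun u v => `[< pres_eq R u v >].

Lemma pres_rel_refl : reflexive pres_rel_bool.
Proof. by move=> u; apply/asboolP; exact: pres_refl. Qed.

Lemma pres_rel_sym : symmetric pres_rel_bool.
Proof. by move=> u v; apply/asboolP/asboolP => /pres_sym. Qed.

Lemma pres_rel_trans : transitive pres_rel_bool.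
Proof.
by move=> v u w /asboolP uv /asboolP vw; apply/asboolP/(pres_trans uv vw).
Qed.

Canonical pres_equiv :=
  EquivRel pres_rel_bool pres_rel_refl pres_rel_sym pres_rel_trans.

Definition presented : Type := {eq_quot pres_equiv}%qT.

HB.instance Definition _ := Choice.on presented.

Definition pres_class (w : word n) : presented := (\pi_presented w)%qT.

Lemma pres_classP u v : pres_class u = pres_class v <-> pres_eq R u v.
Proof.
by split=> [/eqmodP /asboolP|uv]; last by apply/eqmodP/asboolP.
Qed.

Lemma pres_classK (a : presented) : pres_class (repr a) = a.
Proof. exact: reprK. Qed.

Definition inv_word (w : word n) : word n := rev [seq (l.1, ~~ l.2) | l <- w].

Lemma inv_wordK : involutive inv_word.
Proof.
move=> w; rewrite /inv_word map_rev revK -map_comp -[RHS]map_id.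
by apply: eq_map => -[i b] /=; rewrite negbK.
Qed.

Lemma pres_mulVw w : pres_eq R (inv_word w ++ w) [::].
Proof.
elim: w => [|[i b] w IH]; first exact: pres_refl.
rewrite /inv_word /= rev_cons cat_rcons -[_ :: _ :: w]/([:: _; _] ++ w).
apply: pres_trans IH; apply: pres_cat; first exact: pres_refl.
rewrite -[X in pres_eq R _ X]cat0s; apply: pres_cat; last exact: pres_refl.
by rewrite -{2}[b]negbK; exact: pres_cancel.
Qed.

Lemma pres_mulwV w : pres_eq R (w ++ inv_word w) [::].
Proof. by rewrite -{1}[w]inv_wordK; exact: pres_mulVw. Qed.

Lemma pres_inv u v : pres_eq R u v -> pres_eq R (inv_word u) (inv_word v).
Proof.
move=> uv; apply: (@pres_trans _ _ _ (inv_word u ++ (v ++ inv_word v))).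
  rewrite -[X in pres_eq R X _]cats0.
  by apply: pres_cat; [exact: pres_refl | apply/pres_sym/pres_mulwV].
rewrite catA -[X in pres_eq R _ X]cat0s.
apply: pres_cat; last exact: pres_refl.
apply: pres_trans (pres_mulVw u).
by apply: pres_cat; [exact: pres_refl | exact: pres_sym].
Qed.

Definition pres_one : presented := pres_class [::].
Definition pres_mul (a b : presented) : presented :=
  pres_class (repr a ++ repr b).
Definition pres_invg (a : presented) : presented :=
  pres_class (inv_word (repr a)).

Lemma pres_repr u : pres_eq R (repr (pres_class u)) u.
Proof. by apply/pres_classP; rewrite pres_classK. Qed.

Lemma pres_mulE u v :
  pres_mul (pres_class u) (pres_class v) = pres_class (u ++ v).
Proof. by apply/pres_classP/pres_cat; exact: pres_repr. Qed.

Lemma pres_invE u : pres_invg (pres_class u) = pres_class (inv_word u).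
Proof. by apply/pres_classP/pres_inv; exact: pres_repr. Qed.

Lemma pres_mulA : associative pres_mul.
Proof.
move=> a b c; rewrite -[a]pres_classK -[b]pres_classK -[c]pres_classK.
by rewrite !pres_mulE catA.
Qed.

Lemma pres_mul1 : left_id pres_one pres_mul.
Proof. by move=> a; rewrite -[a]pres_classK pres_mulE. Qed.

Lemma pres_mulr1 : right_id pres_one pres_mul.
Proof. by move=> a; rewrite -[a]pres_classK pres_mulE cats0. Qed.

Lemma pres_mulV : left_inverse pres_one pres_invg pres_mul.
Proof.
move=> a; rewrite -[a]pres_classK pres_invE pres_mulE.
by apply/pres_classP/pres_mulVw.
Qed.

Lemma pres_mulrV : right_inverse pres_one pres_invg pres_mul.
Proof.
move=> a; rewrite -[a]pres_classK pres_invE pres_mulE.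
by apply/pres_classP/pres_mulwV.
Qed.

HB.instance Definition _ := isGroup.Build presented
  pres_mulA pres_mul1 pres_mulr1 pres_mulV pres_mulrV.

Definition pres_marking : n.-tuple presented :=
  [tuple pres_class [:: (i, false)] | i < n].

Lemma pres_word_val w : word_val pres_marking w = pres_class w.
Proof.
rewrite /word_val; elim: w => [|[i b] w IH]; first by rewrite big_nil.
rewrite big_cons {}IH tnth_mktuple -(cat1s (i, b)) -[RHS]pres_mulE.
by case: b => //=; rewrite [_^-1]pres_invE.
Qed.

Lemma pres_generates (g : presented) : exists w, word_val pres_marking w = g.
Proof. by exists (repr g); rewrite pres_word_val pres_classK. Qed.

Definition presentation : marked_group n := MarkedGroup pres_generates.

End Presentation.

Section CoRecursivePresentations.
Variables (pr : nat -> nat -> nat) (phi : nat -> pfun).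
Variable theta : forall n, nat -> word n.

Definition coRP (n i : nat) : marked_group n :=
  presentation (~` (theta n @` W phi i)).

Definition coRP_dom (n i : nat) : Prop :=
  0 < n /\ exists M : marked_group n, theta n @` W phi i = coword_problem M.

(** p = <k,i> belongs to the domain of the numbering and its image is G, as a
    marked group up to isomorphism.  The image of <n,i> is n-marked, hence it
    can only be equal to the k-marked group G when n = k. *)
Definition coRP_names (p k : nat) (G : marked_group k) : Prop :=
  exists i, [/\ p = pr k i, coRP_dom k i & marked_iso (coRP k i) G].

Definition co_recursively_presented (k : nat) (G : marked_group k) : Prop :=
  exists p, coRP_names p G.

End CoRecursivePresentations.

(* Main.v *)
(** Let [W_a] and [W_b] be the co-word problems of [G] and [H]; as [H] is a
    quotient of [G], [W_b] is contained in [W_a].  If [F] stopped exactly on the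
    names of [H], the recursion theorem would give an index [i] such that [W_i]
    is [W_b], enlarged to [W_a] as soon as [F] stops on [<k,i>].  Then [<k,i>]
    names [G] if [F] stops on it and names [H] otherwise, a contradiction. *)

Require Import Defs.
From mathcomp Require Import all_boot.
From mathcomp Require Import boolp classical_sets.

Set Implicit Arguments.
Unset Strict Implicit.
Unset Printing Implicit Defensive.

(** * The Cantor pairing function *)

(** One step along the antidiagonals in the order of [cantor]; from the end [(0, b)] of a diagonal
    the walk jumps to [(b.+1, 0)]. *)
Definition unpair_step (p : nat * nat) : nat * nat :=
  if p.1 is a.+1 then (a, p.2.+1) else (p.2.+1, 0).

Definition unpair (n : nat) : nat * nat := iter n unpair_step (0, 0).

Notation ufst n := (unpair n).1.
Notation usnd n := (unpair n).2.

Lemma cantorS a b : cantor a b.+1 = (cantor a.+1 b).+1.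
Proof. by rewrite /cantor !addnS addSn. Qed.

Lemma cantorS0 b : cantor b.+1 0 = (cantor 0 b).+1.
Proof. by rewrite /cantor !addn0 add0n binS bin1 addnS. Qed.

Lemma cantorK a b : unpair (cantor a b) = (a, b).
Proof.
(* Outer induction on the antidiagonal [s], inner induction on the position [b] in it; [b = 0] goes
   back to the last pair of the previous diagonal. *)
move: {2}(a + b) (erefl (a + b)) => s.
elim: s a b => [|s IHs] a b.
  by case: a b => [|a] [|b].
elim: b a => [|b IHb] a.
  rewrite addn0 => ->; rewrite cantorS0 /unpair iterS -/(unpair _).
  by rewrite IHs.
rewrite addnS -addSn => ab; rewrite cantorS /unpair iterS -/(unpair _).
by rewrite IHb.
Qed.

Lemma unpairK n : cantor (ufst n) (usnd n) = n.
Proof.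
elim: n => [|n IH] //.
rewrite -[in RHS]IH /unpair iterS -/(unpair n).
by case: (unpair n) => [[|a] b] /=; rewrite ?cantorS0 ?cantorS.
Qed.

Lemma cantor_inj a b c d : cantor a b = cantor c d -> a = c /\ b = d.
Proof. by move=> /(congr1 unpair); rewrite !cantorK => -[]. Qed.

(** * Computable functions *)

Lemma eval_ufst x : eval Left x (ufst x).
Proof. by rewrite -{1}(unpairK x); exact: eval_left. Qed.

Lemma eval_usnd x : eval Right x (usnd x).
Proof. by rewrite -{1}(unpairK x); exact: eval_right. Qed.

Definition Id : code := Pair Left Right.

Lemma eval_id x : eval Id x x.
Proof.
by rewrite -{2}(unpairK x); apply: eval_pair; [exact: eval_ufst|exact: eval_usnd].
Qed.

Fixpoint Const (n : nat) : code :=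
  if n is m.+1 then Comp Succ (Const m) else Zero.

Lemma eval_const n x : eval (Const n) x n.
Proof.
elim: n => [|n IH] /=; first exact: eval_zero.
by apply: eval_comp IH _; exact: eval_succ.
Qed.

Lemma computable_id : computable id.
Proof. by exists Id; exact: eval_id. Qed.

Lemma computable_const n : computable (fun=> n).
Proof. by exists (Const n); exact: eval_const. Qed.

Lemma computable_comp f g :
  computable f -> computable g -> computable (fun x => f (g x)).
Proof.
by move=> [c fc] [d gd]; exists (Comp c d) => x; apply: eval_comp (gd x) (fc _).
Qed.

Lemma computable_succ f : computable f -> computable (fun x => (f x).+1).
Proof. by apply: computable_comp; exists Succ; exact: eval_succ. Qed.

Lemma computable_ufst f : computable f -> computable (fun x => ufst (f x)).
Proof. by apply: (@computable_comp (fun x => ufst x)); exists Left; exact: eval_ufst. Qed.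

Lemma computable_usnd f : computable f -> computable (fun x => usnd (f x)).
Proof. by apply: (@computable_comp (fun x => usnd x)); exists Right; exact: eval_usnd. Qed.

Lemma computable_cantor f g :
  computable f -> computable g -> computable (fun x => cantor (f x) (g x)).
Proof.
by move=> [c fc] [d gd]; exists (Pair c d) => x; apply: eval_pair.
Qed.

Lemma computable2_comp h f g :
  computable2 h -> computable f -> computable g ->
  computable (fun x => h (f x) (g x)).
Proof.
move=> [c hc] cf cg; case: (computable_cantor cf cg) => d fgd.
by exists (Comp c d) => x; apply: eval_comp (fgd x) (hc _ _).
Qed.

(** [Prec] is run on the pair of [x] and [n x], so [x] stays available as a parameter; the last
    hypothesis unpacks the nested triple that its step program receives. *)
Lemma computable_iteri (n f : nat -> nat) (g : nat -> nat -> nat -> nat) :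
  computable n -> computable f ->
  computable (fun z => g (ufst z) (ufst (usnd z)) (usnd (usnd z))) ->
  computable (fun x => iteri (n x) (g x) (f x)).
Proof.
move=> [cn nE] [cf fE] [cg gE]; exists (Comp (Prec cf cg) (Pair Id cn)) => x.
apply: eval_comp (eval_pair (eval_id x) (nE x)) _.
elim: (n x) => [|m IH] /=; first exact: eval_prec0.
apply: eval_precS IH _.
by have := gE (cantor x (cantor m (iteri m (g x) (f x)))); rewrite !cantorK.
Qed.

(** A case distinction is an iteration whose step ignores the accumulator: only the last round
    counts, and its index is the predecessor of [n x]. *)
Lemma computable_match (n f : nat -> nat) (g : nat -> nat -> nat) :
  computable n -> computable f -> computable (fun z => g (ufst z) (usnd z)) ->
  computable (fun x => if n x is m.+1 then g x m else f x).
Proof.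
move=> nC fC gC.
have : computable (fun x => iteri (n x) (fun m _ => g x m) (f x)).
  apply: computable_iteri => //.
  have := computable_comp gC (computable_cantor (computable_ufst computable_id)
    (computable_ufst (computable_usnd computable_id))).
  by move=> [c cE]; exists c => z; have := cE z; rewrite cantorK.
by move=> [c cE]; exists c => x; have := cE x; case: (n x).
Qed.

(** * Evaluation in bounded time *)

(** [0] stands for "no result within time [t]" and [y.+1] for the result [y];
    in the search loop of [Mu], [0] stands for "still searching", [1] for
    "failed" and [n.+2] for "found [n]". *)
Definition mu_step (h : nat -> nat) (n r : nat) : nat :=
  if r is u.+1 then u.+1 else
  if h n is v.+1 then if v is _.+1 then 0 else n.+2 else 1.

(** The bound [t] limits only the rounds of each [Mu] search, so the recursion is structural in the
    program. The final [.-1] turns the loop states [0] and [1] into [0], and [n.+2] into the result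
    [n.+1]. *)
Fixpoint run (c : code) (t x : nat) : nat :=
  match c with
  | Zero => 1
  | Succ => x.+2
  | Left => (ufst x).+1
  | Right => (usnd x).+1
  | Pair f g =>
      if run f t x is y.+1 then if run g t x is z.+1 then (cantor y z).+1 else 0
      else 0
  | Comp f g => if run g t x is y.+1 then run f t y else 0
  | Prec f g =>
      iteri (usnd x)
        (fun n r => if r is y.+1 then run g t (cantor (ufst x) (cantor n y)) else 0)
        (run f t (ufst x))
  | Mu f => (iteri t (mu_step (fun n => run f t (cantor x n))) 0).-1
  end.

(** The program [c] is fixed, so induction on [c] suffices and no universal program has to be
    built. *)
Lemma computable_run c (t x : nat -> nat) :
  computable t -> computable x -> computable (fun z => run c (t z) (x z)).
Proof.
have cfst := computable_ufst computable_id.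
have csnd := computable_usnd computable_id.
have C := computable_const.
elim: c t x => [||||f IHf g IHg|f IHf g IHg|f IHf g IHg|f IHf] t x Ct Cx /=.
- exact: C.
- by do 2!apply: computable_succ.
- by apply/computable_succ/computable_ufst.
- by apply/computable_succ/computable_usnd.
- apply: (@computable_match _ _ (fun z y =>
    if run g (t z) (x z) is z'.+1 then (cantor y z').+1 else 0)) => //.
    exact: IHf.
  apply: (@computable_match _ _ (fun z z' => (cantor (usnd z) z').+1)) => //.
    by apply: IHg; apply: (computable_comp _ cfst).
  apply/computable_succ/computable_cantor => //.
  exact: computable_usnd.
- apply: (@computable_match _ _ (fun z y => run f (t z) y)) => //.
    exact: IHg.
  by apply: IHf => //; apply: (computable_comp _ cfst).
- apply: (@computable_iteri _ _ (fun z n r =>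
    if r is y.+1 then run g (t z) (cantor (ufst (x z)) (cantor n y)) else 0)).
  + exact: computable_usnd.
  + by apply: IHf => //; apply: computable_ufst.
  apply: (@computable_match _ _ (fun z y =>
     run g (t (ufst z)) (cantor (ufst (x (ufst z))) (cantor (ufst (usnd z)) y)))) => //.
    exact: computable_usnd.
  have c1 := computable_ufst cfst.
  apply: IHg; first exact: (computable_comp Ct).
  apply: computable_cantor; first exact/computable_ufst/(computable_comp Cx).
  apply: computable_cantor => //.
  exact/computable_ufst/computable_usnd.
- suff iterC : computable (fun z =>
      iteri (t z) (mu_step (fun n => run f (t z) (cantor (x z) n))) 0).
    exact: (@computable_match _ _ (fun _ m => m)).
  apply: (@computable_iteri _ _
    (fun z => mu_step (fun n => run f (t z) (cantor (x z) n)))) => //.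
  apply: (@computable_match _ _ (fun z m => m.+1)).
  + exact: computable_usnd.
  + apply: (@computable_match _ _
      (fun z v => if v is _.+1 then 0 else (ufst (usnd z)).+2)) => //.
      apply: IHf; first exact: (computable_comp Ct).
      apply: computable_cantor; first exact: (computable_comp Cx).
      exact: computable_ufst.
    apply: (@computable_match _ _ (fun _ _ => 0)) => //.
    by do 2!apply: computable_succ; apply/computable_ufst/computable_usnd.
  + exact: computable_succ.
Qed.

Lemma run_sound c t x y : run c t x = y.+1 -> eval c x y.
Proof.
elim: c x y => [||||f IHf g IHg|f IHf g IHg|f IHf g IHg|f IHf] x y /=.
- by case=> <-; exact: eval_zero.
- by case=> <-; exact: eval_succ.
- by case=> <-; exact: eval_ufst.
- by case=> <-; exact: eval_usnd.
- case Ef: run => [//|u]; case Eg: run => [//|v] [<-].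
  by apply: eval_pair; [exact: IHf|exact: IHg].
- by case Eg: run => [//|u] /IHf; apply: eval_comp; exact: IHg.
- rewrite -[X in eval _ X](unpairK x).
  elim: (usnd x) y => [|n IHn] y /=; first by move=> /IHf; exact: eval_prec0.
  by case Er: (iteri n _ _) => [//|u] /IHg; apply: eval_precS; exact: IHn.
- set q := iteri t _ 0; case Eq: q => [|m] //= ?; subst m; move: Eq.
  (* Loop invariant: state [0] certifies that all values met so far are positive, which is what
     [eval_mu] asks for below the zero. *)
  suff : (q = 0 -> forall m, m < t -> exists v, eval f (cantor x m) v.+1) /\
         (q = y.+2 -> eval (Mu f) x y) by case.
  (* The induction is on the number of rounds only; the bound inside [run f t] stays fixed. *)
  rewrite /q; elim: {1 3 4}t => [|m [IH0 IH1]] //=; split.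
    rewrite {1}/mu_step; case: (iteri m _ 0) IH0 => // /(_ erefl) IH0.
    case Er: run => [|[|v]] // _ j; rewrite ltnS leq_eqVlt => /predU1P[->|].
      by exists v; exact: IHf.
    exact: IH0.
  rewrite {1}/mu_step; case: (iteri m _ 0) IH0 IH1 => [|[|u]] // /(_ erefl) IH0 IH1.
  by case Er: run => [|[|v]] // [<-]; apply: eval_mu => //; exact: IHf.
Qed.

(** Covering every later [t] lets the bounds for subprograms be combined by their maximum. *)
Lemma run_complete c x y :
  eval c x y -> exists t0, forall t, t0 <= t -> run c t x = y.+1.
Proof.
elim: c x y => [||||f IHf g IHg|f IHf g IHg|f IHf g IHg|f IHf] x y ev.
- by exists 0 => t _; inversion ev.
- by exists 0 => t _; inversion ev.
- by exists 0 => t _; inversion ev; rewrite /= cantorK.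
- by exists 0 => t _; inversion ev; rewrite /= cantorK.
- inversion_clear ev as [| | | |? ? ? u v evf evg| | | |].
  have [[s sP] [s' sP']] := (IHf _ _ evf, IHg _ _ evg).
  by exists (maxn s s') => t; rewrite geq_max /= => /andP[/sP-> /sP'->].
- inversion_clear ev as [| | | | |? ? ? u v evg evf| | |].
  have [[s sP] [s' sP']] := (IHg _ _ evg, IHf _ _ evf).
  by exists (maxn s s') => t; rewrite geq_max /= => /andP[/sP-> /sP'->].
- move: ev; rewrite -{1}(unpairK x) /=.
  elim: (usnd x) y => [|n IHn] y ev.
    inversion ev as [| | | | | |? ? ? u evf Ef E Ey|? ? ? ? ? ? ? ? Ef E Ey|].
      by have [Ea _] := cantor_inj E; subst; exact: IHf.
    by have [] := cantor_inj E.
  inversion ev as [| | | | | |? ? ? u evf Ef E Ey|? ? ? ? u v evn evg Ef E Ey|].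
    by have [] := cantor_inj E.
  have [Ea [En]] := cantor_inj E; subst.
  have [s sP] := IHn _ evn; have [s' sP'] := IHg _ _ evg.
  by exists (maxn s s') => t; rewrite geq_max /= => /andP[/sP-> /sP'->].
- inversion_clear ev as [| | | | | | | |? ? ? evf lt_y].
  have [s sP] := IHf _ _ evf.
  have [s' sP'] : exists s', forall t, s' <= t ->
      forall m, m < y -> exists v, run f t (cantor x m) = v.+2.
    elim: (y) lt_y => [|n IHn] lt_n; first by exists 0.
    have [|s1 s1P] := IHn; first by move=> m mn; apply/lt_n/ltnW.
    have [v /IHf[s2 s2P]] := lt_n n (ltnSn n).
    exists (maxn s1 s2) => t; rewrite geq_max => /andP[/s1P t1 /s2P t2] m.
    rewrite ltnS leq_eqVlt => /predU1P[->|]; last exact: t1.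
    by exists v.
  (* [y.+1] rounds let the search reach [y]; [s] and [s'] secure the values at [y] and below it. *)
  exists (maxn y.+1 (maxn s s')) => t; rewrite !geq_max => /and3P[yt /sP ty /sP' lty].
  rewrite /=; set st := mu_step _.
  have q0 m : m <= y -> iteri m st 0 = 0.
    elim: m => [|m IHm] //= my; rewrite IHm; last exact: ltnW.
    by rewrite /st /=; have [v ->] := lty m my.
  suff -> : iteri t st 0 = y.+2 by [].
  (* Round [y] produces the state [y.+2], which [mu_step] never leaves. *)
  rewrite -(subnKC yt); elim: (t - y.+1) => [|d IHd].
    by rewrite addn0 /= q0 // /st /= ty.
  by rewrite addnS iteriS IHd.
Qed.

(** Both results are read off the same [run], at a time beyond both bounds. *)
Lemma eval_det c x y z : eval c x y -> eval c x z -> y = z.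
Proof.
move=> /run_complete[s sP] /run_complete[t tP].
by have := sP _ (leq_maxl s t); rewrite tP ?leq_maxr // => -[].
Qed.

(** * Domains of programs *)

Definition halts (c : code) (x : nat) : Prop := exists y, eval c x y.

Lemma halts_mu c h x :
  (forall z, eval c z (h z)) -> halts (Mu c) x <-> exists n, h (cantor x n) = 0.
Proof.
move=> cE; split=> [[n ev]|].
  inversion_clear ev as [| | | | | | | |? ? ? ev0 _].
  by exists n; apply: eval_det (cE _) ev0.
move=> hx; have {}hx : exists n, h (cantor x n) == 0.
  by case: hx => n ?; exists n; apply/eqP.
case: (ex_minnP hx) => n /eqP h0 minn; exists n; apply: eval_mu.
  by rewrite -h0.
move=> m mn; exists (h (cantor x m)).-1; rewrite prednK //.
by rewrite lt0n; apply: contraL mn => /minn; rewrite leqNgt.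
Qed.

(** Dovetailing: a [Mu] search for a time at which [run] gives a result for [c] or for [d]. *)
Lemma halts_union c d : exists e, forall x, halts e x <-> halts c x \/ halts d x.
Proof.
pose h z := if run c (usnd z) (ufst z) is _.+1 then 0 else
            if run d (usnd z) (ufst z) is _.+1 then 0 else 1.
have [e eE] : computable h.
  have cfst := computable_ufst computable_id.
  have csnd := computable_usnd computable_id.
  have C := computable_const.
  apply: (@computable_match _ _ (fun _ _ => 0)) => //; first exact: computable_run.
  apply: (@computable_match _ _ (fun _ _ => 0)) => //; exact: computable_run.
exists (Mu e) => x; rewrite (halts_mu _ eE); split=> [[n]|].
  rewrite /h cantorK /=; case Ec: run => [|y].
    by case Ed: run => [|y] // _; right; exists y; exact: run_sound Ed.
  by move=> _; left; exists y; exact: run_sound Ec.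
case=> -[y /run_complete[t tP]]; exists t; rewrite /h cantorK /= tP //.
by case: run.
Qed.

Lemma halts_pair c d x : halts (Pair c d) x <-> halts c x /\ halts d x.
Proof.
split=> [[y ev]|[[y cy] [z dz]]]; last by exists (cantor y z); apply: eval_pair.
by inversion ev; split; eexists; eassumption.
Qed.

Lemma eval_compE c d f :
  (forall x, eval d x (f x)) -> forall x y, eval (Comp c d) x y <-> eval c (f x) y.
Proof.
move=> dE x y; split=> [ev|]; last exact: eval_comp (dE x).
inversion_clear ev as [| | | | |? ? ? u v evd evc| | |].
by rewrite (eval_det (dE x) evd).
Qed.

Lemma halts_comp c d f :
  (forall x, eval d x (f x)) -> forall x, halts (Comp c d) x <-> halts c (f x).
Proof.
by move=> dE x; split=> -[y /(eval_compE c dE) ?]; exists y.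
Qed.

(** * The recursion theorem *)

Lemma goedel_inj : injective goedel.
Proof.
elim=> [||||f IHf g IHg|f IHf g IHg|f IHf g IHg|f IHf] [] //=;
  try by [move=> > /cantor_inj[]|move=> /cantor_inj[]].
- by move=> f' g' /cantor_inj[_ /cantor_inj[/IHf-> /IHg->]].
- by move=> f' g' /cantor_inj[_ /cantor_inj[/IHf-> /IHg->]].
- by move=> f' g' /cantor_inj[_ /cantor_inj[/IHf-> /IHg->]].
- by move=> f' /cantor_inj[_ /IHf->].
Qed.

Lemma goedel_funE c x y : goedel_fun (goedel c) x y <-> eval c x y.
Proof. by split=> [[d [/goedel_inj->]]|ev] //; exists c. Qed.

(** The diagonal construction: [c] is fed its own Goedel number as first argument. *)
Definition Self (c : code) : code := Comp c (Pair (Const (goedel c)) Id).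

Lemma eval_self c x y : eval (Self c) x y <-> eval c (cantor (goedel c) x) y.
Proof.
apply: eval_compE => {}x.
by apply: eval_pair; [exact: eval_const|exact: eval_id].
Qed.

Lemma computable_goedel_self :
  exists2 s, computable s & forall c, s (goedel c) = goedel (Self c).
Proof.
(* Mirrors [Const] on Goedel numbers: [5] is the tag of [Comp], and [cantor 1 0] and [cantor 0 0]
   are the numbers of [Succ] and [Zero]. *)
pose const m := iteri m (fun _ r => cantor 5 (cantor (cantor 1 0) r)) (cantor 0 0).
have constE m : const m = goedel (Const m) by elim: m => //= m <-.
exists (fun m => cantor 5 (cantor m (cantor 4 (cantor (const m) (goedel Id))))).
  have C := computable_const; have I := computable_id.
  do 4!apply: computable_cantor => //.
  apply: (@computable_iteri _ _ (fun _ _ r => cantor 5 (cantor (cantor 1 0) r))) => //.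
  do 2!apply: computable_cantor => //.
  by do 2!apply: computable_usnd.
by move=> c; rewrite constE.
Qed.

Lemma recursion_theorem phi c : standard_enumeration phi ->
  exists i, forall x y, phi i x y <-> eval c (cantor i x) y.
Proof.
move=> [_ [g [gC gE]]]; have [s sC sE] := computable_goedel_self.
have [d dE] : computable (fun z => cantor (g (s (ufst z))) (usnd z)).
  apply: computable_cantor; last exact: computable_usnd computable_id.
  exact/(computable_comp gC)/(computable_comp sC)/computable_ufst/computable_id.
(* On [cantor m x], [e] runs [c] on [cantor (g (s m)) x]. For [m = goedel e] the number [g (s m)] is
   the chosen index itself. *)
pose e := Comp c d; exists (g (goedel (Self e))) => x y.
by rewrite -gE goedel_funE eval_self (eval_compE c dE) cantorK sE.
Qed.

Lemma halts_W phi a : standard_enumeration phi ->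
  exists c, forall x, W phi a x <-> halts c x.
Proof.
move=> [[f [_ fE]] _].
have [[c cE]|noc] := pselect (exists c, goedel c = f a).
  exists c => x; split=> -[y]; first by move/fE; rewrite -cE goedel_funE; exists y.
  by rewrite -goedel_funE cE -fE; exists y.
(* When [f a] is no Goedel number the domain is empty; [Mu Succ] never stops, as a successor is
   never zero. *)
exists (Mu Succ) => x; rewrite (halts_mu _ eval_succ); split=> [[y]|[] //].
by move/fE=> [c [cE _]]; case: noc; exists c.
Qed.

(** * Marked groups and their co-word problems *)

Local Open Scope group_scope.
Local Open Scope classical_set_scope.

Lemma word_val_cat (K : groupType) n (S : n.-tuple K) u v :
  word_val S (u ++ v) = word_val S u * word_val S v.
Proof. exact: big_cat. Qed.

Lemma word_val_letter (K : groupType) n (S : n.-tuple K) i :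
  word_val S [:: (i, false)] = tnth S i.
Proof. exact: big_seq1. Qed.

Lemma word_val_inv (K : groupType) n (S : n.-tuple K) w :
  word_val S (inv_word w) = (word_val S w)^-1.
Proof.
elim: w => [|[i b] w IH]; first by rewrite /word_val !big_nil invg1.
rewrite /inv_word /= rev_cons -cats1 word_val_cat -/(inv_word w) IH.
rewrite -[in RHS]cat1s [in RHS]word_val_cat invgM; congr (_ * _).
by rewrite /word_val !big_seq1; case: b => //=; rewrite invgK.
Qed.

Lemma word_val_eqE (K : groupType) n (S : n.-tuple K) u v :
  word_val S u = word_val S v <-> word_val S (u ++ inv_word v) = 1.
Proof.
rewrite word_val_cat word_val_inv; split=> [->|/divg1_eq //]; exact: mulgV.
Qed.

Lemma marked_morphism_word k (G H : marked_group k) (f : G -> H) w :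
  marked_morphism f -> f (word_val (marking G) w) = word_val (marking H) w.
Proof.
move=> [fM fS].
have f1 : f 1 = 1 by apply: (mulgI (f 1)); rewrite -fM !mulg1.
have fV x : f x^-1 = (f x)^-1.
  by apply: (mulgI (f x)); rewrite -fM !mulgV.
rewrite /word_val (big_morph f fM f1); apply: eq_bigr => -[i []] _ //=.
by rewrite fV fS.
Qed.

Lemma coword_quotient k (G H : marked_group k) :
  marked_quotient G H -> coword_problem H `<=` coword_problem G.
Proof.
move=> [f fG] w Hw Gw; apply: Hw.
rewrite -(marked_morphism_word w fG) Gw.
by have := marked_morphism_word [::] fG; rewrite /word_val !big_nil.
Qed.

(** An element of [G] goes to the value in [H] of a chosen word for it. The choice is harmless: a
    word trivial in [G] is trivial in [H]. *)
Lemma quotient_coword k (G H : marked_group k) :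
  coword_problem H `<=` coword_problem G ->
  exists f : G -> H, marked_morphism f /\
    forall w, f (word_val (marking G) w) = word_val (marking H) w.
Proof.
move=> HG; have [r rK] := choice (@marking_generates k G).
have fE w : word_val (marking H) (r (word_val (marking G) w)) = word_val (marking H) w.
  apply/word_val_eqE; apply: contrapT => /HG; apply.
  exact/word_val_eqE/rK.
exists (fun x => word_val (marking H) (r x)); split=> //; split=> [x y|i].
  rewrite -word_val_cat -[in RHS]fE; congr (word_val _ (r _)).
  by rewrite word_val_cat !rK.
by rewrite -[in LHS]word_val_letter fE word_val_letter.
Qed.

Lemma marked_isoP k (G H : marked_group k) :
  marked_iso G H <-> coword_problem G = coword_problem H.
Proof.
split=> [[f [fG [g fK gK]]]|GH].
  apply/seteqP; split; last by apply: coword_quotient; exists f.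
  move=> w Gw Hw; apply: Gw; apply: (can_inj fK).
  rewrite (marked_morphism_word w fG) Hw.
  by have := marked_morphism_word [::] fG; rewrite /word_val !big_nil.
have [|f [fG fE]] := @quotient_coword _ G H; first by rewrite GH.
have [|g [_ gE]] := @quotient_coword _ H G; first by rewrite GH.
exists f; split=> //; exists g => x.
  by have [w <-] := marking_generates x; rewrite fE gE.
by have [w <-] := marking_generates x; rewrite gE fE.
Qed.

(** Every word trivial in [M] is itself a relator; conversely, the congruence generated by these
    relators holds in [M]. *)
Lemma coword_presentation k (M : marked_group k) :
  coword_problem (presentation (~` coword_problem M)) = coword_problem M.
Proof.
set R := ~` _.
have sound u v : pres_eq R u v -> word_val (marking M) u = word_val (marking M) v.
  elim=> {u v} [//|u v _ ->//|u v w _ -> _ ->//|u u' v v' _ uu' _ vv'|i b|r /contrapT->].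
  - by rewrite !word_val_cat uu' vv'.
  - rewrite /word_val big_cons big_seq1 big_nil.
    by case: b; rewrite /= ?mulgV ?mulVg.
  - by rewrite /word_val big_nil.
have presE w : word_val (marking (presentation R)) w = 1 <-> pres_eq R w [::].
  by rewrite pres_word_val; exact: pres_classP.
apply/seteqP; split=> w; apply: contra_not.
  by move=> Mw; apply/presE/pres_rel => /(_ Mw).
by move/presE/sound => ->; rewrite /word_val big_nil.
Qed.

(** * Names of marked groups, and the impossibility of recognizing the quotient *)

Lemma coRP_namesE pr phi theta p k (G : marked_group k) :
  coRP_names pr phi theta p G <->
  exists i, [/\ p = pr k i, 0 < k & @theta k @` W phi i = coword_problem G].
Proof.
split=> [[i [-> [k0 [M WM]]]]|[i [-> k0 WG]]].
  rewrite /coRP WM => /marked_isoP; rewrite coword_presentation => MG.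
  by exists i; rewrite WM.
exists i; split=> //; first by split=> //; exists G.
by rewrite /coRP WG; apply/marked_isoP; exact: coword_presentation.
Qed.

Theorem lemma38
    (pr : nat -> nat -> nat) (phi : nat -> pfun)
    (theta : forall n : nat, nat -> word n)
    (pr_computable : computable_pairing pr)
    (phi_standard : standard_enumeration phi)
    (theta_computable : computable_word_numbering theta)
    (k : nat) (G H : marked_group k)
    (G_coRP : co_recursively_presented pr phi theta G)
    (H_coRP : co_recursively_presented pr phi theta H)
    (GH_strict : strict_marked_quotient G H) :
  ~ exists F : pfun,
      partial_computable F /\
      forall p : nat,
        coRP_names pr phi theta p G \/ coRP_names pr phi theta p H ->
        (defined F p <-> coRP_names pr phi theta p H).
Proof.
move=> [F [[c FE] Fspec]].
have {}FE x : defined F x <-> halts c x by split=> -[y /FE]; exists y.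
have [_ /coRP_namesE[a [_ k_gt0 WaG]]] := G_coRP.
have [_ /coRP_namesE[b [_ _ WbH]]] := H_coRP.
have [/coword_quotient subHG notiso] := GH_strict.
have [ca caE] := halts_W a phi_standard.
have [cb cbE] := halts_W b phi_standard.
(* On input [cantor i x], [d] forms the name [pr k i] on which [F] is to be tested. *)
have [d dE] : computable (fun z => pr k (ufst z)).
  apply: computable2_comp (computable_const k) _; first by case: pr_computable.
  exact: computable_ufst computable_id.
(* [Pair] acts as a conjunction: its second program stops when [x] is in [W phi a] and [F] stops on
   the name. *)
have [e eE] := halts_union (Comp cb Right) (Pair (Comp ca Right) (Comp c d)).
have [i iE] := recursion_theorem e phi_standard.
have WiE x : W phi i x <-> W phi b x \/ W phi a x /\ defined F (pr k i).
  have -> : W phi i x <-> halts e (cantor i x) by split=> -[y /iE]; exists y.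
  rewrite eE halts_pair !(halts_comp _ eval_usnd) (halts_comp _ dE) cantorK.
  by rewrite caE cbE FE.
have [Fi|notFi] := pselect (defined F (pr k i)).
  have WiG : @theta k @` W phi i = coword_problem G.
    have -> : W phi i = W phi b `|` W phi a.
      by apply/seteqP; split=> x; rewrite WiE /=; tauto.
    by rewrite image_setU WaG WbH; exact/setUidPr.
  (* [pr k i] names [G] and [F] stops on it, so it also names [H], a priori through another index
     [j]; injectivity of [pr] then gives [i = j]. *)
  have [j [/= eq_ij _ WjH]] : exists j,
      [/\ pr k i = pr k j, 0 < k & @theta k @` W phi j = coword_problem H].
    by apply/coRP_namesE/Fspec => //; left; apply/coRP_namesE; exists i.
  have [_ [u [v [_ _ uvK _]]]] := pr_computable.
  have ij : i = j by rewrite -(uvK k i).2 eq_ij (uvK k j).2.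
  by apply/notiso/marked_isoP; rewrite -WiG ij.
have Hi : coRP_names pr phi theta (pr k i) H.
  apply/coRP_namesE; exists i; split=> //; rewrite -WbH; congr (_ @` _).
  by apply/seteqP; split=> x; rewrite WiE; tauto.
(* As a name of [H], [pr k i] would have to make [F] stop. *)
by apply/notFi/Fspec => //; right.
Qed.
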